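(* Let $E$ be an acyclic graph, and let $\leq$ be the partial order on $E^0$ defined by: $e\leq f$ iff there exists a path $u$ such that $s(u)=f$ and $r(u)=e$. Then the following statements hold: (1) $G(E)=\bigcup_{e\in E^0}D_e^0$; (2) $D_e^0$ is isomorphic to the semigroup of $I_e\times I_e$-matrix units $\mathcal{B}^0_{I_e}$, for each vertex $e\in E^0$; (3) $D_e^0\cap D_f^0=\{0\}$ for all distinct vertices $e,f\in E^0$; (4) for $e,f\in E^0$, if $e\leq f$ then $D_e^0\cdot D_f^0\cup D_f^0\cdot D_e^0\subseteq D_e^0$; (5) for $e,f\in E^0$, if $e\nleq f$ and $f\nleq e$ then $D_e^0\cdot D_f^0\cup D_f^0\cdot D_e^0=\{0\}$.
   Context: Graphs and paths. A graph means a directed graph $E=(E^0,E^1,r,s)$: disjoint sets $E^0$ (vertices) and $E^1$ (edges) with functions $s,r:E^1\to E^0$ (source and range). A path of non-zero length is a finite sequence of edges $x=e_1\ldots e_n$ ($n\ge 1$) with $r(e_i)=s(e_{i+1})$ for $i<n$; put $s(x)=s(e_1)$, $r(x)=r(e_n)$, $|x|=n$. Each vertex $e$ is a path of length $0$ with $s(e)=r(e)=e$. $\operatorname{Path}(E)$ is the set of all paths. If $r(a)=s(b)$, then $ab$ is the concatenation (vertices act as identities). A cycle is a path $x$ with $s(x)=r(x)$ and $|x|>0$; $E$ is acyclic if it contains no cycles. Graph inverse semigroup. $G(E)$ is the semigroup with zero $0$ generated by $E^0$, $E^1$ and $E^{-1}=\{e^{-1}\mid e\in E^1\}$ (disjoint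 from $E^0\cup E^1$) subject to, for $a,b\in E^0$, $e,f\in E^1$: (1) $a\cdot b=a$ if $a=b$ and $a\cdot b=0$ if $a\ne b$; (2) $s(e)\cdot e=e\cdot r(e)=e$; (3) $e^{-1}\cdot s(e)=r(e)\cdot e^{-1}=e^{-1}$; (4) $e^{-1}\cdot f=r(e)$ if $e=f$ and $e^{-1}\cdot f=0$ if $e\neq f$. Each non-zero element is uniquely of the form $uv^{-1}$ with $u,v\in\operatorname{Path}(E)$, $r(u)=r(v)$, and $u_1v_1^{-1}\cdot u_2v_2^{-1}$ equals $u_1wv_2^{-1}$ if $u_2=v_1w$ for a path $w$, equals $u_1(v_2w)^{-1}$ if $v_1=u_2w$ for a path $w$, and equals $0$ otherwise. $\mathcal{D}$-classes. On a semigroup, Green's relations are: $a\mathcal{R}b$ (resp. $a\mathcal{L}b$) iff $a$ and $b$ generate the same principal right (resp. left) ideal, and $\mathcal{D}=\mathcal{L}\circ\mathcal{R}=\mathcal{R}\circ\mathcal{L}$. Each non-zero $\mathcal{D}$-class of $G(E)$ contains exactly one vertex; $D_e$ denotes the $\mathcal{D}$-class containing the vertex $e$, i.e. $D_e=\{uv^{-1}\mid u,v\in\operatorname{Path}(E),\ r(u)=r(v)=e\}$; $D_e^0=D_e\cup\{0\}$. $I_e=\{u\in\operatorname{Path}(E)\mid r(u)=e\}$. For a non-empty set $X$, the semigroup of $X\times X$-matrix units $\mathcal{B}^0_X$ is (up to isomorphism) the set $(X\times X)\sqcup\{0\}$ with $(a,b)\cdot(c,d)=(a,d)$ if $b=c$,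 $(a,b)\cdot(c,d)=0$ if $b\neq c$, and all products involving $0$ equal to $0$. For subsets $P,Q$ of a semigroup, $P\cdot Q=\{pq\mid p\in P,\ q\in Q\}$. *)

(* Defs.v *)
From HB Require Import structures.
From mathcomp Require Import all_boot.
From mathcomp Require Import boolp classical_sets functions.

Set Implicit Arguments.
Unset Strict Implicit.
Unset Printing Implicit Defensive.

Local Open Scope classical_set_scope.
Local Open Scope group_scope.
Local Open Scope quotient_scope.

Record graph := Graph {
  vertex : Type;
  edge : Type;
  src : edge -> vertex;
  rng : edge -> vertex }.

Section Paths.
Variable E : graph.

Fixpoint is_path (v : vertex E) (p : seq (edge E)) : Prop :=
  if p is e :: p' then src e = v /\ is_path (rng e) p' else True.

(* The source is stored so that the empty edge sequence at [v] is the path [v]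
   of length 0; on non-empty sequences it is determined by the first edge. *)
Record gpath := GPath {
  psrc : vertex E;
  pedges : seq (edge E);
  _ : is_path psrc pedges }.

Definition prng (p : gpath) : vertex E :=
  last (psrc p) [seq rng e | e <- pedges p].

Definition is_cycle (p : gpath) : Prop :=
  psrc p = prng p /\ (0 < size (pedges p))%N.

Definition acyclic : Prop := forall p : gpath, ~ is_cycle p.

Definition vle (e f : vertex E) : Prop :=
  exists u : gpath, psrc u = f /\ prng u = e.

Lemma vle_refl e : vle e e.
Proof. by exists (@GPath e [::] I). Qed.

Lemma gpath_cat (u w : gpath) : prng u = psrc w ->
  exists p : gpath, [/\ psrc p = psrc u, prng p = prng w &
                        pedges p = pedges u ++ pedges w].
Proof.
case: u w => v p Hp [v' q Hq]; rewrite /prng /= => euv.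
have Hpq : is_path v (p ++ q).
  elim: p v Hp euv => [|a p IH] v /=; first by move=> _ ->.
  by case=> sa Hp euv; split=> //; apply: IH.
by exists (GPath Hpq); rewrite /= map_cat last_cat euv.
Qed.

Lemma vle_trans e f g : vle e f -> vle f g -> vle e g.
Proof.
move=> [u [su ru]] [w [sw rw]].
have [|p [sp rp _]] := @gpath_cat w u; first by rewrite rw su.
by exists p; rewrite sp rp.
Qed.

Lemma vle_antisym e f : acyclic -> vle e f -> vle f e -> e = f.
Proof.
move=> acE [u [su ru]] [w [sw rw]].
have [|p [sp rp ep]] := @gpath_cat u w; first by rewrite ru sw.
case: u su ru sp ep => v [|a s] Hs /= su ru sp ep.
  by rewrite -ru -su.
by case: (acE p); split; rewrite ?ep // sp rp rw su.
Qed.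

(* The paths ending at [e], called I_e. *)
Definition paths_to (e : vertex E) : Type := {u : gpath | prng u = e}.

End Paths.

Section Presentation.
Variable E : graph.

Inductive gterm :=
  | TZero
  | TVert of vertex E
  | TEdge of edge E
  | TInv of edge E
  | TMul of gterm & gterm.

(* The constructors up to [gc_mult0] give the least congruence whose quotient is
   a semigroup with zero [TZero], i.e. the free one on the generators; the
   others are the defining relations of the graph inverse semigroup G(E). *)
Inductive gcong : gterm -> gterm -> Prop :=
  | gc_refl x : gcong x x
  | gc_sym x y : gcong x y -> gcong y x
  | gc_trans x y z : gcong x y -> gcong y z -> gcong x z
  | gc_mul x x' y y' :
      gcong x x' -> gcong y y' -> gcong (TMul x y) (TMul x' y')
  | gc_assoc x y z : gcong (TMul x (TMul y z)) (TMul (TMul x y) z)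
  | gc_mul0t x : gcong (TMul TZero x) TZero
  | gc_mult0 x : gcong (TMul x TZero) TZero
  | gc_vv a : gcong (TMul (TVert a) (TVert a)) (TVert a)
  | gc_vv0 a b : a <> b -> gcong (TMul (TVert a) (TVert b)) TZero
  | gc_se e : gcong (TMul (TVert (src e)) (TEdge e)) (TEdge e)
  | gc_er e : gcong (TMul (TEdge e) (TVert (rng e))) (TEdge e)
  | gc_is e : gcong (TMul (TInv e) (TVert (src e))) (TInv e)
  | gc_ri e : gcong (TMul (TVert (rng e)) (TInv e)) (TInv e)
  | gc_ie e : gcong (TMul (TInv e) (TEdge e)) (TVert (rng e))
  | gc_ie0 e f : e <> f -> gcong (TMul (TInv e) (TEdge f)) TZero.

HB.instance Definition _ := gen_eqMixin gterm.
HB.instance Definition _ := gen_choiceMixin gterm.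

Definition gcongb : rel gterm := fun x y => `[< gcong x y >].

Lemma gcongb_refl : reflexive gcongb.
Proof. by move=> x; apply/asboolP; exact: gc_refl. Qed.

Lemma gcongb_sym : symmetric gcongb.
Proof. by move=> x y; apply/asboolP/asboolP => /gc_sym. Qed.

Lemma gcongb_trans : transitive gcongb.
Proof.
move=> y x z /asboolP xy /asboolP yz; apply/asboolP; exact: gc_trans xy yz.
Qed.

Canonical gcong_equiv := EquivRel gcongb gcongb_refl gcongb_sym gcongb_trans.

Definition graph_inverse_semigroup : Type := {eq_quot gcong_equiv}.
HB.instance Definition _ := Choice.on graph_inverse_semigroup.

Definition gmk (t : gterm) : graph_inverse_semigroup := \pi_({eq_quot gcong_equiv}) t.

Definition gmul (x y : graph_inverse_semigroup) : graph_inverse_semigroup :=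
  gmk (TMul (repr (x : {eq_quot gcong_equiv})) (repr (y : {eq_quot gcong_equiv}))).

Lemma gmkP (s t : gterm) : gmk s = gmk t <-> gcong s t.
Proof.
split=> [/(@eqmodP _ gcong_equiv) /asboolP //|st].
by apply/(@eqmodP _ gcong_equiv)/asboolP.
Qed.

Lemma gmkK (x : graph_inverse_semigroup) :
  gmk (repr (x : {eq_quot gcong_equiv})) = x.
Proof. exact: reprK. Qed.

Lemma gmul_mk (s t : gterm) : gmul (gmk s) (gmk t) = gmk (TMul s t).
Proof. by apply/gmkP; apply: gc_mul; apply/gmkP; rewrite gmkK. Qed.

Lemma gmulA : associative gmul.
Proof.
move=> x y z; rewrite -(gmkK x) -(gmkK y) -(gmkK z) !gmul_mk.
by apply/gmkP; exact: gc_assoc.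
Qed.

HB.instance Definition _ := isSemigroup.Build graph_inverse_semigroup gmulA.

Definition gzero : graph_inverse_semigroup := gmk TZero.
Definition gvert (e : vertex E) : graph_inverse_semigroup := gmk (TVert e).

End Presentation.

Section Green.
Variable S : semigroupType.

Definition right_ideal (a : S) : set S :=
  [set x | x = a \/ exists s, x = a * s].
Definition left_ideal (a : S) : set S :=
  [set x | x = a \/ exists s, x = s * a].

Definition greenR (a b : S) : Prop := right_ideal a = right_ideal b.
Definition greenL (a b : S) : Prop := left_ideal a = left_ideal b.
Definition greenD (a b : S) : Prop := exists c, greenL a c /\ greenR c b.

Definition setprod (P Q : set S) : set S := [set p * q | p in P & q in Q].

End Green.

(* D_e and D_e^0 = D_e `|` {0}. *)
Definition Dclass (E : graph) (e : vertex E) : set (graph_inverse_semigroup E) :=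
  [set x | greenD (gvert e) x].

Definition Dclass0 (E : graph) (e : vertex E) : set (graph_inverse_semigroup E) :=
  Dclass e `|` [set gzero E].

(* Matrix units over [X]; [None] is the zero. *)
Section MatrixUnits.
Variable X : Type.

Definition matrix_units : Type := option (X * X).
HB.instance Definition _ := gen_eqMixin matrix_units.
HB.instance Definition _ := gen_choiceMixin matrix_units.

Definition mu_mul (x y : matrix_units) : matrix_units :=
  match x, y with
  | Some (a, b), Some (c, d) => if `[< b = c >] then Some (a, d) else None
  | _, _ => None
  end.

Lemma mu_mulA : associative mu_mul.
Proof.
move=> [[a b]|] [[c d]|] [[e f]|] //=; case: asboolP => //= bc.
- by case: asboolP => //= de; rewrite asboolT.
- by case: asboolP => //= de; rewrite asboolF.
Qed.

HB.instance Definition _ := isSemigroup.Build matrix_units mu_mulA.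

End MatrixUnits.

(* The subset [A] of [S] is isomorphic to [T]; that [A] is closed under the
   product of [S] is implied, as [A] is the image of the morphism. *)
Definition subset_isomorphic (S T : semigroupType) (A : set S) : Prop :=
  exists f : T -> S, {morph f : x y / x * y} /\ set_bij [set: T] A f.

(* Main.v *)
Require Import Defs.
From mathcomp Require Import all_boot.
From mathcomp Require Import boolp classical_sets functions.

Set Implicit Arguments.
Unset Strict Implicit.
Unset Printing Implicit Defensive.

Local Open Scope classical_set_scope.

(** The theorem rests on two facts about the elements [nf u v], which are the
    products u v^-1 of paths u and v with the same range.

    Multiplication: in u v^-1 p q^-1 the middle factor v^-1 p cancels edge by
    edge, so it is zero unless one of v and p is a prefix of the other. If
    p = v w, the product is (u w) q^-1 and w leads from r(v) to r(p); if
    v = p w, it is u (q w)^-1 and w leads from r(p) to r(v) ([nf_mulP]). Hence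
    every nonzero element of G(E) has this form ([zero_or_nf]), and a nonzero
    product of elements with ranges e and f forces e and f to be comparable and
    has as range the lower of the two ([Dclass0_mul]). This settles the products
    of two different classes. When e = f, the path w is closed, so it has length 0 because the graph is
    acyclic, and v = p: this is the multiplication of matrix units.

    Uniqueness: distinct pairs give distinct nonzero elements. The presentation
    does not show this by itself, so G(E) is made to act on finite edge
    sequences, each with a marked initial vertex: an edge is put in front, its
    inverse removes it, and a vertex keeps the sequences that it marks. Then
    u v^-1 replaces the prefix v by u ([gact_nf]), and both u and v can be read
    off ([nf_inj]).

    The same action computes Green's relations: L-related elements have the same
    domain and R-related ones the same image, so D_e consists of the u v^-1
    with range e ([DclassP]). Hence the classes cover G(E), and by uniqueness
    they meet only in zero. *)

Section GraphInverseSemigroup.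
Local Open Scope group_scope.
Variable E : graph.

Local Notation G := (graph_inverse_semigroup E).
Local Notation zero := (gzero E : G).

Implicit Types (v w : vertex E) (e f : edge E) (p q x : seq (edge E)).

(** * Paths *)

Lemma gpath_eq (u v : gpath E) :
  psrc u = psrc v -> pedges u = pedges v -> u = v.
Proof.
case: u v => a p Hp [b q Hq] /= ab pq; case: _ / ab in Hq *.
by case: _ / pq in Hq *; congr GPath; exact: Prop_irrelevance.
Qed.

Definition end_vertex v p := last v [seq rng e | e <- p].

Lemma prngE (u : gpath E) : end_vertex (psrc u) (pedges u) = prng u.
Proof. by []. Qed.

Lemma gpathP (u : gpath E) : is_path (psrc u) (pedges u).
Proof. by case: u. Qed.

Lemma is_path_cat v p q :
  is_path v (p ++ q) <-> is_path v p /\ is_path (end_vertex v p) q.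
Proof.
elim: p v => [|e p IH] v /=; first by split=> [|[]].
by split=> [[-> /IH[]]|[[-> Hp] Hq]] //; split=> //; apply/IH.
Qed.

Definition is_concat (u w p : gpath E) : Prop :=
  [/\ prng u = psrc w, psrc p = psrc u & pedges p = pedges u ++ pedges w].

Lemma is_concat_prng (u w p : gpath E) : is_concat u w p -> prng p = prng w.
Proof.
case=> uw pu ep; rewrite /prng ep pu map_cat last_cat -/(prng u) uw //.
Qed.

Lemma is_concat_ex (u w : gpath E) :
  prng u = psrc w -> exists p : gpath E, is_concat u w p.
Proof. by move=> uw; have [p [? _ ?]] := gpath_cat uw; exists p. Qed.

Lemma is_concat_vle (u w p : gpath E) :
  is_concat u w p -> vle (prng p) (prng u).
Proof.
by move=> c; exists w; rewrite (is_concat_prng c); case: c => ->.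
Qed.

Lemma is_concat_acyclic (u w p : gpath E) :
  acyclic E -> is_concat u w p -> prng p = prng u -> p = u.
Proof.
move=> acE c pu; have pw := is_concat_prng c; case: c => uw sp ep.
case: (posnP (size (pedges w))) => [/size0nil w0 | w_gt0].
  by apply: gpath_eq => //; rewrite ep w0 cats0.
by case: (acE w); split; rewrite // -uw -pw pu.
Qed.

Definition vpath v : gpath E := @GPath E v [::] I.
Definition epath e : gpath E := @GPath E (src e) [:: e] (conj erefl I).

(** * Paths as elements of the semigroup *)

Definition gedge e : G := gmk (TEdge e).
Definition ginv e : G := gmk (TInv e).

Lemma mul_mk (s t : gterm E) : (gmk s : G) * gmk t = gmk (TMul s t).
Proof. exact: gmul_mk. Qed.

Lemma gmul0x (a : G) : zero * a = zero.
Proof. by rewrite -(gmkK a) mul_mk; apply/gmkP; exact: gc_mul0t. Qed.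

Lemma gmulx0 (a : G) : a * zero = zero.
Proof. by rewrite -(gmkK a) mul_mk; apply/gmkP; exact: gc_mult0. Qed.

Lemma gvert_idem v : (gvert v : G) * gvert v = gvert v.
Proof. by rewrite mul_mk; apply/gmkP; exact: gc_vv. Qed.

Lemma gvert_orth v w : v <> w -> (gvert v : G) * gvert w = zero.
Proof. by move=> vw; rewrite mul_mk; apply/gmkP; exact: gc_vv0. Qed.

Lemma src_gedge e : (gvert (src e) : G) * gedge e = gedge e.
Proof. by rewrite mul_mk; apply/gmkP; exact: gc_se. Qed.

Lemma gedge_rng e : gedge e * gvert (rng e) = gedge e.
Proof. by rewrite mul_mk; apply/gmkP; exact: gc_er. Qed.

Lemma ginv_src e : ginv e * gvert (src e) = ginv e.
Proof. by rewrite mul_mk; apply/gmkP; exact: gc_is. Qed.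

Lemma rng_ginv e : (gvert (rng e) : G) * ginv e = ginv e.
Proof. by rewrite mul_mk; apply/gmkP; exact: gc_ri. Qed.

Lemma ginv_gedge e : ginv e * gedge e = gvert (rng e).
Proof. by rewrite mul_mk; apply/gmkP; exact: gc_ie. Qed.

Lemma ginv_gedge0 e f : e <> f -> ginv e * gedge f = zero.
Proof. by move=> ef; rewrite mul_mk; apply/gmkP; exact: gc_ie0. Qed.

(** The vertex argument matters only for the empty sequence: G(E) has no unit,
    and the path of length 0 at [v] is the idempotent [v]. *)
Fixpoint path_elt v p : G :=
  if p is e :: p' then gedge e * path_elt (rng e) p' else gvert v.

Fixpoint path_inv v p : G :=
  if p is e :: p' then path_inv (rng e) p' * ginv e else gvert v.

Lemma src_path_elt v p :
  is_path v p -> (gvert v : G) * path_elt v p = path_elt v p.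
Proof.
case: p => [|e p] /=; first by rewrite gvert_idem.
by case=> <- _; rewrite mulgA src_gedge.
Qed.

Lemma path_inv_src v p :
  is_path v p -> path_inv v p * gvert v = path_inv v p.
Proof.
case: p => [|e p] /=; first by rewrite gvert_idem.
by case=> <- _; rewrite -mulgA ginv_src.
Qed.

Lemma path_elt_cat v p q : is_path v (p ++ q) ->
  path_elt v (p ++ q) = path_elt v p * path_elt (end_vertex v p) q.
Proof.
elim: p v => [|e p IH] v /=; first by move=> /src_path_elt ->.
by case=> _ /IH ->; rewrite mulgA.
Qed.

Lemma path_inv_cat v p q : is_path v (p ++ q) ->
  path_inv v (p ++ q) = path_inv (end_vertex v p) q * path_inv v p.
Proof.
elim: p v => [|e p IH] v /=; first by move=> /path_inv_src ->.
by case=> _ /IH ->; rewrite mulgA.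
Qed.

(** All cancellation in G(E) happens here: the innermost factors e^-1 f vanish
    unless e = f, in which case they become a vertex that the next factors
    absorb, until one of the two paths is used up. *)
Lemma path_inv_eltP v w p q : is_path v p -> is_path w q ->
  [\/ path_inv v p * path_elt w q = zero,
      v = w /\ exists x, q = p ++ x /\
        path_inv v p * path_elt w q = path_elt (end_vertex v p) x |
      v = w /\ exists x, p = q ++ x /\
        path_inv v p * path_elt w q = path_inv (end_vertex w q) x].
Proof.
elim: p v w q => [|e p IH] v w q /=.
  move=> _ Hq; have [vw|vw] := pselect (v = w).
    by apply: Or32; split=> //; exists q; rewrite vw src_path_elt.
  by apply: Or31; rewrite -(src_path_elt Hq) mulgA gvert_orth // gmul0x.
case=> <- Hp; case: q => [_|f q [<- Hq]] /=.
  have [->|vw] := pselect (w = src e).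
    by apply: Or33; split=> //; exists (e :: p); rewrite -mulgA ginv_src.
  apply: Or31; rewrite -ginv_src -!mulgA gvert_orth ?gmulx0 //.
  by move/esym.
rewrite mulgA -(mulgA _ (ginv e)).
move: Hq; have [<- Hq|ef _] := pselect (e = f); last first.
  by apply: Or31; rewrite ginv_gedge0 // gmulx0 gmul0x.
rewrite ginv_gedge path_inv_src //.
have [Hz|[_ [x [-> Hx]]]|[_ [x [-> Hx]]]] := IH (rng e) (rng e) q Hp Hq.
- exact: Or31.
- by apply: Or32; split=> //; exists x.
- by apply: Or33; split=> //; exists x.
Qed.

Lemma path_elt_rng v p :
  is_path v p -> path_elt v p * gvert (end_vertex v p) = path_elt v p.
Proof. by move=> Hp; rewrite -(@path_elt_cat v p [::]) cats0. Qed.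

Lemma path_inv_elt v p :
  is_path v p -> path_inv v p * path_elt v p = gvert (end_vertex v p).
Proof.
elim: p v => [|e p IH] v /=; first by rewrite gvert_idem.
case=> _ Hp; rewrite mulgA -(mulgA _ (ginv e)) ginv_gedge path_inv_src //.
exact: IH.
Qed.

(** * The elements u v^-1 *)

Definition nf (u v : gpath E) : G :=
  path_elt (psrc u) (pedges u) * path_inv (psrc v) (pedges v).

Lemma nf_vpath v : nf (vpath v) (vpath v) = gvert v.
Proof. exact: gvert_idem. Qed.

Lemma nf_mul_diag (u v q : gpath E) : prng u = prng v ->
  nf u v * nf v q = nf u q.
Proof.
move=> uv; rewrite /nf mulgA -(mulgA _ _ (path_elt _ _)).
rewrite path_inv_elt; last exact: gpathP.
by rewrite prngE -uv path_elt_rng //; exact: gpathP.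
Qed.

(** The path w of the second and third alternatives is what [vle] asks for:
    it joins the ranges of the two factors. *)
Lemma nf_mulP (u v p q : gpath E) : prng u = prng v -> prng p = prng q ->
  [\/ nf u v * nf p q = zero,
      exists w u' : gpath E, [/\ is_concat v w p, is_concat u w u' &
                                 nf u v * nf p q = nf u' q] |
      exists w q' : gpath E, [/\ is_concat p w v, is_concat q w q' &
                                 nf u v * nf p q = nf u q']].
Proof.
move=> uv pq; rewrite /nf mulgA -(mulgA _ _ (path_elt (psrc p) _)).
have [->|[svp [x [ex ->]]]|[svp [x [ex ->]]]] :=
    path_inv_eltP (gpathP v) (gpathP p).
- by apply: Or31; rewrite gmulx0 gmul0x.
- apply: Or32; have Hx : is_path (prng v) x.
    by have := gpathP p; rewrite ex -svp => /is_path_cat[].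
  have [u' c] := @is_concat_ex u (GPath Hx) uv.
  exists (GPath Hx), u'; split=> //.
  case: (c) => _ su' eu'; have := gpathP u'; rewrite su' eu' => Hu'.
  by rewrite (path_elt_cat Hu') !prngE uv.
- apply: Or33; have Hx : is_path (prng p) x.
    by have := gpathP v; rewrite ex svp => /is_path_cat[].
  have [q' c] := @is_concat_ex q (GPath Hx) (esym pq).
  exists (GPath Hx), q'; split=> //.
  case: (c) => _ sq' eq'; have := gpathP q'; rewrite sq' eq' => Hq'.
  by rewrite -mulgA (path_inv_cat Hq') !prngE -pq.
Qed.

(** The generators have this form, and by [nf_mulP] products preserve it. *)
Lemma zero_or_nf (a : G) :
  a = zero \/ exists u v : gpath E, prng u = prng v /\ a = nf u v.
Proof.
rewrite -(gmkK a); elim: (repr _) => [|v|e|e|s IHs t IHt]; first by left.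
- by right; exists (vpath v), (vpath v); rewrite nf_vpath.
- right; exists (epath e), (vpath (rng e)); split=> //.
  by rewrite /nf /= -mulgA gvert_idem gedge_rng.
- right; exists (vpath (rng e)), (epath e); split=> //.
  by rewrite /nf /= mulgA gvert_idem rng_ginv.
rewrite -mul_mk; case: IHs => [->|[u [v [uv ->]]]].
  by left; rewrite gmul0x.
case: IHt => [->|[p [q [pq ->]]]]; first by left; rewrite gmulx0.
have [->|[w [u' [vwp uwu' ->]]]|[w [q' [pwv qwq' ->]]]] := nf_mulP uv pq.
- by left.
- right; exists u', q; split=> //.
  by rewrite (is_concat_prng uwu') -(is_concat_prng vwp).
- right; exists u, q'; split=> //.
  by rewrite (is_concat_prng qwq') -(is_concat_prng pwv).
Qed.

(** * The action on marked edge sequences *)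

Implicit Types (m n : vertex E * seq (edge E)).

(** G(E) acts by partial injections; encoding them as relations makes the
    product of terms a relational composite, so associativity and the zero laws
    hold by logic alone. Sequences need not be paths: only the marked vertex
    decides whether an edge may be put in front. It is a left action, so the
    right factor of a product acts first. *)
Fixpoint act (t : gterm E) m n : Prop :=
  match t with
  | TZero => False
  | TVert v => m = n /\ m.1 = v
  | TEdge e => exists x, m = (rng e, x) /\ n = (src e, e :: x)
  | TInv e => exists x, n = (rng e, x) /\ m = (src e, e :: x)
  | TMul s t => exists k, act t m k /\ act s k n
  end.

Lemma act_gcong (s t : gterm E) :
  gcong s t -> forall m n, act s m n <-> act t m n.
Proof.
elim=> {s t} /=.
- by [].
- by move=> s t _ IH m n; split=> /IH.
- by move=> s t r _ IH1 _ IH2 m n; split=> [/IH1 /IH2|/IH2 /IH1].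
- move=> s s' t t' _ IHs _ IHt m n.
  by split=> -[k [/IHt mk /IHs kn]]; exists k.
- move=> s t r m n; split.
    by case=> k [[l [ml lk]] kn]; exists l; split=> //; exists k.
  by case=> l [ml [k [lk kn]]]; exists k; split=> //; exists l.
- by move=> t m n; split=> // -[k []].
- by move=> t m n; split=> // -[k []].
- by move=> v m n; split=> [[k [[-> <-] []]]|[<- <-]] //; exists m.
- move=> v w vw m n; split=> // -[k [[<- mw] [_ mv]]].
  by case: vw; rewrite -mv mw.
- move=> e m n; split=> [[k [[x [-> ->]] [<- _]]]|[x [-> ->]]].
    by exists x.
  by exists (src e, e :: x); split=> //; exists x.
- move=> e m n; split=> [[k [[-> _] [x [-> ->]]]]|[x [-> ->]]].
    by exists x.
  by exists (rng e, x); split=> //; exists x.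
- move=> e m n; split=> [[k [[-> _] [x [-> ->]]]]|[x [-> ->]]].
    by exists x.
  by exists (src e, e :: x); split=> //; exists x.
- move=> e m n; split=> [[k [[x [-> ->]] [<- _]]]|[x [-> ->]]].
    by exists x.
  by exists (rng e, x); split=> //; exists x.
- move=> e m n; split=> [[k [[x [-> ->]] [y [-> [->]]]]]|] //.
  case: m => v x [<- /= <-]; exists (src e, e :: x).
  by split; exists x.
- by move=> e f ef m n; split=> // -[k [[x [_ ->]] [y [_ [_ /esym]]]]].
Qed.

Definition gact (a : G) m n : Prop := exists t, gmk t = a /\ act t m n.

Lemma gact_mk (t : gterm E) m n : gact (gmk t) m n <-> act t m n.
Proof.
split=> [[s [/gmkP st ]]|]; last by exists t.
by move/(act_gcong st).
Qed.

Lemma gact_mul (a b : G) m n :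
  gact (a * b) m n <-> exists k, gact b m k /\ gact a k n.
Proof.
rewrite -(gmkK a) -(gmkK b) mul_mk.
split=> [/gact_mk [k [mk kn]]|[k [/gact_mk mk /gact_mk kn]]].
  by exists k; split; apply/gact_mk.
by apply/gact_mk; exists k.
Qed.

Lemma gact_gvert v m n : gact (gvert v) m n <-> m = n /\ m.1 = v.
Proof. exact: gact_mk. Qed.

Lemma gact_path_elt v p m n : is_path v p -> gact (path_elt v p) m n <->
  exists x, m = (end_vertex v p, x) /\ n = (v, p ++ x).
Proof.
elim: p v m n => [|e p IH] v m n /=.
  move=> _; split=> [/gact_gvert[<-]|[x [-> ->]]]; last exact/gact_gvert.
  by case: m => w x /= ->; exists x.
case=> <- Hp; split=> [/gact_mul[k [/(IH _ _ _ Hp)[x [-> ->]]]]|[x [-> ->]]].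
  by move/gact_mk => [y [[<-] ->]]; exists x.
apply/gact_mul; exists (rng e, p ++ x); split; first by apply/(IH _ _ _ Hp); exists x.
by apply/gact_mk; exists (p ++ x).
Qed.

Lemma gact_path_inv v p m n :
  gact (path_inv v p) m n <-> gact (path_elt v p) n m.
Proof.
elim: p v m n => [|e p IH] v m n /=.
  by split=> /gact_gvert[-> ?]; apply/gact_gvert.
split=> /gact_mul[k [mk kn]]; apply/gact_mul; exists k; split.
- exact/IH.
- by move/gact_mk: mk => mk; apply/gact_mk.
- by move/gact_mk: kn => kn; apply/gact_mk.
- exact/IH.
Qed.

Lemma gact_nf (u v : gpath E) m n : prng u = prng v ->
  gact (nf u v) m n <-> exists x, m = (psrc v, pedges v ++ x) /\
                                  n = (psrc u, pedges u ++ x).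
Proof.
move=> uv; split=> [/gact_mul[k []]|[x [-> ->]]].
  move/gact_path_inv/gact_path_elt => /(_ (gpathP v)) [x [-> ->]].
  by move/gact_path_elt => /(_ (gpathP u)) [y [[_ ->] ->]]; exists y.
apply/gact_mul; exists (prng u, x); split.
  by apply/gact_path_inv/gact_path_elt; [exact: gpathP | exists x; rewrite uv].
by apply/gact_path_elt; [exact: gpathP | exists x].
Qed.

Lemma gact_zero m n : ~ gact zero m n.
Proof. by move/gact_mk. Qed.

Lemma nf_neq0 (u v : gpath E) : prng u = prng v -> nf u v <> zero.
Proof.
move=> uv uv0; apply: (@gact_zero (psrc v, pedges v) (psrc u, pedges u)).
by rewrite -uv0; apply/gact_nf => //; exists [::]; rewrite !cats0.
Qed.

(** * Green's relations *)

Lemma greenL_dom (a b : G) m n :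
  greenL a b -> gact a m n -> exists k, gact b m k.
Proof.
move=> ab; have : left_ideal a a by left.
rewrite ab => -[-> mn|[s -> /gact_mul[k [mk _]]]]; first by exists n.
by exists k.
Qed.

Lemma greenR_image (a b : G) m n :
  greenR a b -> gact a m n -> exists k, gact b k n.
Proof.
move=> ab; have : right_ideal a a by left.
rewrite ab => -[-> mn|[s -> /gact_mul[k [_ kn]]]]; first by exists m.
by exists k.
Qed.

Lemma greenL_nf_prefix (u v p q : gpath E) :
  prng u = prng v -> prng p = prng q -> greenL (nf u v) (nf p q) ->
  psrc v = psrc q /\ exists x, pedges v = pedges q ++ x.
Proof.
move=> uv pq /greenL_dom H.
have [|k /gact_nf-/(_ pq)[x [[svq e] _]]] :=
    H (psrc v, pedges v) (psrc u, pedges u).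
  by apply/gact_nf => //; exists [::]; rewrite !cats0.
by split=> //; exists x.
Qed.

Lemma greenR_nf_prefix (u v p q : gpath E) :
  prng u = prng v -> prng p = prng q -> greenR (nf u v) (nf p q) ->
  psrc u = psrc p /\ exists x, pedges u = pedges p ++ x.
Proof.
move=> uv pq /greenR_image H.
have [|k /gact_nf-/(_ pq)[x [_ [sup e]]]] :=
    H (psrc v, pedges v) (psrc u, pedges u).
  by apply/gact_nf => //; exists [::]; rewrite !cats0.
by split=> //; exists x.
Qed.

Lemma prefix_antisym (T : Type) (s t x y : seq T) :
  s = t ++ x -> t = s ++ y -> s = t.
Proof.
move=> sx ty; have /eqP : size t = size t + (size x + size y).
  by rewrite {1}ty sx !size_cat addnA.
rewrite -{1}[size t]addn0 eqn_add2l eq_sym addn_eq0 => /andP[/eqP/size0nil x0 _].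
by rewrite sx x0 cats0.
Qed.

(** The domain of u v^-1 consists of the sequences extending v. *)
Lemma greenL_nf (u v p q : gpath E) :
  prng u = prng v -> prng p = prng q -> greenL (nf u v) (nf p q) -> v = q.
Proof.
move=> uv pq L; have [svq [x ex]] := greenL_nf_prefix uv pq L.
have [_ [y ey]] := greenL_nf_prefix pq uv (esym L).
by apply: gpath_eq => //; exact: prefix_antisym ex ey.
Qed.

(** The image of u v^-1 consists of the sequences extending u. *)
Lemma greenR_nf (u v p q : gpath E) :
  prng u = prng v -> prng p = prng q -> greenR (nf u v) (nf p q) -> u = p.
Proof.
move=> uv pq R; have [sup [x ex]] := greenR_nf_prefix uv pq R.
have [_ [y ey]] := greenR_nf_prefix pq uv (esym R).
by apply: gpath_eq => //; exact: prefix_antisym ex ey.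
Qed.

Lemma nf_inj (u v p q : gpath E) : prng u = prng v -> prng p = prng q ->
  nf u v = nf p q -> u = p /\ v = q.
Proof.
by move=> uv pq e; split; [apply: (greenR_nf uv pq) | apply: (greenL_nf uv pq)];
   rewrite /greenR /greenL e.
Qed.

Lemma left_ideal_sub (a b s : G) :
  a = s * b -> left_ideal a `<=` left_ideal b.
Proof.
move=> -> x [->|[t ->]]; right; first by exists s.
by exists (t * s); rewrite mulgA.
Qed.

Lemma right_ideal_sub (a b s : G) :
  a = b * s -> right_ideal a `<=` right_ideal b.
Proof.
move=> -> x [->|[t ->]]; right; first by exists s.
by exists (s * t); rewrite mulgA.
Qed.

Lemma nf_greenL (u v p : gpath E) : prng u = prng v -> prng p = prng v ->
  greenL (nf u v) (nf p v).
Proof.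
move=> uv pv; apply/seteqP; split.
  by apply: (@left_ideal_sub _ _ (nf u p)); rewrite nf_mul_diag ?uv.
by apply: (@left_ideal_sub _ _ (nf p u)); rewrite nf_mul_diag ?uv.
Qed.

Lemma nf_greenR (u v q : gpath E) : prng u = prng v -> prng u = prng q ->
  greenR (nf u v) (nf u q).
Proof.
move=> uv uq; apply/seteqP; split.
  by apply: (@right_ideal_sub _ _ (nf q v)); rewrite nf_mul_diag.
by apply: (@right_ideal_sub _ _ (nf v q)); rewrite nf_mul_diag.
Qed.

(** The vertex e is related to u v^-1 through u: the equation u^-1 u = e gives
    e L u, and u v^-1 v = u gives u R u v^-1. *)
Lemma DclassP v (a : G) : Dclass v a <->
  exists p q : gpath E, [/\ prng p = v, prng q = v & a = nf p q].
Proof.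
split=> [[c []]|[p [q [pv qv ->]]]].
  rewrite -nf_vpath => vc ca.
  have [c0|[p [q [pq ec]]]] := zero_or_nf c.
    have [|k] := @greenL_dom _ _ (v, [::]) (v, [::]) vc.
      by apply/gact_nf => //; exists [::].
    by rewrite c0 => /gact_zero.
  move: vc ca; rewrite ec => /greenL_nf-/(_ erefl pq) vq pa.
  have [a0|[u [w [uw ea]]]] := zero_or_nf a.
    have [|k] := @greenR_image _ _ (psrc q, pedges q) (psrc p, pedges p) pa.
      by apply/gact_nf => //; exists [::]; rewrite !cats0.
    by rewrite a0 => /gact_zero.
  move: pa; rewrite ea => /greenR_nf-/(_ pq uw) pu.
  by exists u, w; rewrite -uw -pu pq -vq.
exists (nf p (vpath v)); rewrite -nf_vpath; split; first exact: nf_greenL.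
by apply: nf_greenR; rewrite pv.
Qed.

Lemma Dclass0P v (a : G) : Dclass0 v a <->
  a = zero \/ exists p q : gpath E, [/\ prng p = v, prng q = v & a = nf p q].
Proof.
by split=> [[/DclassP ?|->]|[->|/DclassP ?]]; [right|left|right|left].
Qed.

Lemma Dclass0_zero v : Dclass0 v zero.
Proof. by right. Qed.

(** The path that [nf_mulP] attaches to a nonzero product compares the two
    vertices; this is the common source of absorption and orthogonality. *)
Lemma Dclass0_mul v w (a b : G) : Dclass0 v a -> Dclass0 w b ->
  [\/ a * b = zero,
      vle w v /\ Dclass0 w (a * b) |
      vle v w /\ Dclass0 v (a * b)].
Proof.
move=> /Dclass0P[->|[p [q [pv qv ->]]]].
  by move=> _; apply: Or31; rewrite gmul0x.
move=> /Dclass0P[->|[p' [q' [pw qw ->]]]]; first by apply: Or31; rewrite gmulx0.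
have [||->|[x [u [c cu ->]]]|[x [u [c cu ->]]]] := @nf_mulP p q p' q'.
- by rewrite qv.
- by rewrite qw.
- exact: Or31.
- apply: Or32; split; first by rewrite -pw -qv; exact: is_concat_vle c.
  apply/Dclass0P; right; exists u, q'; split=> //.
  by rewrite (is_concat_prng cu) -(is_concat_prng c).
- apply: Or33; split; first by rewrite -pw -qv; exact: is_concat_vle c.
  apply/Dclass0P; right; exists p, u; split=> //.
  by rewrite (is_concat_prng cu) -(is_concat_prng c).
Qed.

(** The path w of [nf_mulP] starts and ends at the common range, and acyclicity
    makes it trivial. *)
Lemma nf_mul_offdiag (u v p q : gpath E) : acyclic E ->
  prng u = prng v -> prng p = prng q -> prng v = prng p -> v <> p ->
  nf u v * nf p q = zero.
Proof.
move=> acE uv pq vp nvp.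
have [//|[w [_ [c _ _]]]|[w [_ [c _ _]]]] := nf_mulP uv pq.
  by case: nvp; rewrite (is_concat_acyclic acE c).
by case: nvp; rewrite (is_concat_acyclic acE c).
Qed.

(** * The structure theorem *)

Lemma Dclass0_cover : inhabited (vertex E) ->
  [set: G] = \bigcup_(v in [set: vertex E]) Dclass0 v.
Proof.
move=> [v0]; apply/seteqP; split=> // a _.
have [->|[u [v [uv ->]]]] := zero_or_nf a.
  by exists v0 => //; exact: Dclass0_zero.
by exists (prng v) => //; apply/Dclass0P; right; exists u, v.
Qed.

Definition unit_nf v (m : matrix_units (paths_to v)) : G :=
  if m is Some (a, b) then nf (sval a) (sval b) else zero.

Lemma paths_to_inj v : injective (fun a : paths_to v => sval a).
Proof.
by move=> [u uv] [u' u'v] /= e; case: _ / e in u'v *; congr exist;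
  exact: Prop_irrelevance.
Qed.

Lemma unit_nf_morph v : acyclic E -> {morph @unit_nf v : m n / m * n}.
Proof.
move=> acE [[a b]|] [[c d]|]; rewrite [X in unit_nf X]/mul /= ?gmul0x ?gmulx0 //.
have [Ha Hb Hc Hd] := And4 (svalP a) (svalP b) (svalP c) (svalP d).
case: asboolP => [<-|bc]; first by rewrite /= nf_mul_diag // Ha.
rewrite /= nf_mul_offdiag // ?Ha ?Hb ?Hc //.
by move=> e; apply: bc; exact: paths_to_inj.
Qed.

Lemma Dclass0_matrix_units v : acyclic E ->
  subset_isomorphic (matrix_units (paths_to v)) (Dclass0 v).
Proof.
move=> acE; exists (@unit_nf v); split; first exact: unit_nf_morph.
split=> [m _||a].
- case: m => [[[p Hp] [q Hq]]|]; last exact: Dclass0_zero.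
  by apply/Dclass0P; right; exists p, q.
- have ab (a b : paths_to v) : prng (sval a) = prng (sval b).
    by rewrite (svalP a) (svalP b).
  move=> [[a b]|] [[c d]|] _ _ //=.
  + by move=> /nf_inj[] // /paths_to_inj -> /paths_to_inj ->.
  + by move/nf_neq0 => [].
  + by move/esym/nf_neq0 => [].
- move=> /Dclass0P[->|[p [q [pv qv ->]]]]; first by exists None.
  by exists (Some (exist _ p pv, exist _ q qv)).
Qed.

Lemma Dclass0_disjoint v w :
  v <> w -> Dclass0 v `&` Dclass0 w = [set zero].
Proof.
move=> vw; apply/seteqP; split=> [a []|_ ->]; last by split; right.
move=> /Dclass0P[->|[p [q [pv qv ->]]]] //.
move=> /Dclass0P[->|[p' [q' [pw qw]]]] //.
move/nf_inj; rewrite pv qv pw qw => /(_ erefl erefl)[e _].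
by case: vw; rewrite -pv -pw e.
Qed.

(** A nonzero product that lands in the class of [w] needs w <= v, and then
    v = w by antisymmetry; this is where acyclicity enters. *)
Lemma Dclass0_absorb v w : acyclic E -> vle v w ->
  setprod (Dclass0 v) (Dclass0 w) `|` setprod (Dclass0 w) (Dclass0 v)
    `<=` Dclass0 v.
Proof.
move=> acE vw _ [[a va [b wb <-]]|[a wa [b vb <-]]].
  have [->|[wv ab]|[_ ab]] := Dclass0_mul va wb => //; first by right.
  by rewrite (vle_antisym acE vw wv).
have [->|[_ ab]|[wv ab]] := Dclass0_mul wa vb => //; first by right.
by rewrite (vle_antisym acE vw wv).
Qed.

Lemma Dclass0_orth v w : ~ vle v w -> ~ vle w v ->
  setprod (Dclass0 v) (Dclass0 w) `|` setprod (Dclass0 w) (Dclass0 v)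
    = [set zero].
Proof.
move=> nvw nwv; apply/seteqP; split=> [_ [[a va [b wb <-]]|[a wa [b vb <-]]]|_ ->].
- by have [->|[/nwv]|[/nvw]] := Dclass0_mul va wb.
- by have [->|[/nvw]|[/nwv]] := Dclass0_mul wa vb.
left; exists zero; first exact: Dclass0_zero.
by exists zero; [exact: Dclass0_zero | exact: gmul0x].
Qed.

End GraphInverseSemigroup.

Theorem theorem11 (E : graph) (acE : acyclic E) :
  (inhabited (vertex E) ->
     [set: graph_inverse_semigroup E] =
     \bigcup_(e in [set: vertex E]) Dclass0 e) /\
  (forall e : vertex E,
     subset_isomorphic (matrix_units (paths_to e)) (Dclass0 e)) /\
  (forall e f : vertex E, e <> f ->
     Dclass0 e `&` Dclass0 f = [set gzero E]) /\
  (forall e f : vertex E, vle e f ->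
     setprod (Dclass0 e) (Dclass0 f) `|` setprod (Dclass0 f) (Dclass0 e)
       `<=` Dclass0 e) /\
  (forall e f : vertex E, ~ vle e f -> ~ vle f e ->
     setprod (Dclass0 e) (Dclass0 f) `|` setprod (Dclass0 f) (Dclass0 e)
       = [set gzero E]).
Proof.
split; first exact: Dclass0_cover.
split; first by move=> e; exact: Dclass0_matrix_units.
split; first exact: Dclass0_disjoint.
split; last exact: Dclass0_orth.
by move=> e f; exact: Dclass0_absorb.
Qed.
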